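(* For any set $X$, $|X| \notin \Delta_5$ if and only if there is a subset $T$ of $X$ which carries a well-founded tree structure of height $\omega$ with no leaves.
   Context: The axiom of choice is not assumed (work in ZF, or in ZF with atoms). $\Delta_5$ is the class of cardinalities $|X|$ of sets $X$ such that there is no surjection from $X$ to a proper superset of $X$ (equivalently, every surjection from $X$ to $X$ is injective). A tree is a partially ordered set $(T,\le)$ in which any two elements have a common lower bound and, for every $x\in T$, the set $\{y\in T: y\le x\}$ is linearly ordered by the restriction of $\le$. It is well-founded if it has a unique least element (the root) and each set $\{y \in T: y\le x\}$ is well-ordered. The levels $L_\alpha$ of a well-founded tree are defined recursively: $L_\alpha$ is the set of minimal elements of $T\setminus\bigcup_{\beta<\alpha}L_\beta$. The height of the tree is the least ordinal $\alpha$ with $L_\alpha=\emptyset$. A leaf is a maximal element. *)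

(* Defs.v *)
(* Sets are the elements of an arbitrary first-order model of ZFA (Zermelo-Fraenkel
   set theory with a set of atoms, without choice); models of ZF are those whose set
   of atoms is empty.  A statement quantified over all models says that it is provable
   in ZFA (soundness and completeness of first-order logic).  Separation and
   replacement range over first-order formulas with parameters, not over all Rocq
   predicates, so choice principles of the metatheory do not carry over to the model.
   Functions, orders, ordinals, etc. are likewise elements of the model. *)

Set Implicit Arguments.
Unset Strict Implicit.

(* De Bruijn variables; the language contains membership and equality only, since the
   constants for the empty set and the set of atoms can be passed as parameters. *)
Inductive formula : Type :=
| fMem (i j : nat)
| fEq (i j : nat)
| fFalse
| fImp (p q : formula)
| fAnd (p q : formula)
| fOr (p q : formula)
| fAll (p : formula)
| fEx (p : formula).

Definition scons (V : Type) (x : V) (e : nat -> V) (n : nat) : V :=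
  match n with O => x | S m => e m end.

Fixpoint sat (V : Type) (mem : V -> V -> Prop) (p : formula) (e : nat -> V) : Prop :=
  match p with
  | fMem i j => mem (e i) (e j)
  | fEq i j => e i = e j
  | fFalse => False
  | fImp q r => sat mem q e -> sat mem r e
  | fAnd q r => sat mem q e /\ sat mem r e
  | fOr q r => sat mem q e \/ sat mem r e
  | fAll q => forall x : V, sat mem q (scons x e)
  | fEx q => exists x : V, sat mem q (scons x e)
  end.

Record ZFA : Type := {
  carrier :> Type;
  mem : carrier -> carrier -> Prop;
  empty : carrier;
  atoms : carrier;
  ax_empty : forall z, ~ mem z empty;
  ax_atoms : forall z, mem z atoms <-> z <> empty /\ forall x, ~ mem x z;
  ax_extensionality : forall x y, ~ mem x atoms -> ~ mem y atoms ->
    (forall z, mem z x <-> mem z y) -> x = y;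
  ax_pairing : forall x y, exists p, forall z, mem z p <-> z = x \/ z = y;
  ax_union : forall x, exists u, ~ mem u atoms /\
    forall z, mem z u <-> exists y, mem y x /\ mem z y;
  ax_power : forall x, exists p, forall y,
    mem y p <-> ~ mem y atoms /\ forall z, mem z y -> mem z x;
  ax_infinity : exists w, mem empty w /\
    forall x, mem x w -> exists y, mem y w /\ forall z, mem z y <-> mem z x \/ z = x;
  ax_foundation : forall x, (exists y, mem y x) ->
    exists y, mem y x /\ forall z, mem z x -> ~ mem z y;
  ax_separation : forall (p : formula) (e : nat -> carrier) x,
    exists y, ~ mem y atoms /\
      forall z, mem z y <-> mem z x /\ sat mem p (scons z e);
  ax_replacement : forall (p : formula) (e : nat -> carrier) x,
    (forall u v w, mem u x -> sat mem p (scons u (scons v e)) ->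
                   sat mem p (scons u (scons w e)) -> v = w) ->
    exists y, ~ mem y atoms /\
      forall v, mem v y <-> exists u, mem u x /\ sat mem p (scons u (scons v e))
}.

Declare Scope zfa_scope.
Open Scope zfa_scope.
Notation "x ∈ y" := (mem x y) (at level 70, no associativity) : zfa_scope.

Definition is_set (M : ZFA) (x : M) : Prop := ~ x ∈ atoms M.

Definition subset (M : ZFA) (x y : M) : Prop :=
  is_set x /\ is_set y /\ forall z, z ∈ x -> z ∈ y.

Definition proper_subset (M : ZFA) (x y : M) : Prop := subset x y /\ x <> y.

Definition is_upair (M : ZFA) (p x y : M) : Prop :=
  forall z, z ∈ p <-> z = x \/ z = y.

(* Kuratowski pairs *)
Definition is_pair (M : ZFA) (p x y : M) : Prop :=
  forall z, z ∈ p <-> is_upair z x x \/ is_upair z x y.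

Definition rel (M : ZFA) (R x y : M) : Prop := exists p, is_pair p x y /\ p ∈ R.

Definition is_function_on (M : ZFA) (f A : M) : Prop :=
  is_set f /\
  (forall p, p ∈ f -> exists x y, is_pair p x y /\ x ∈ A) /\
  (forall x, x ∈ A -> exists! y, rel f x y).

Definition is_function (M : ZFA) (f A B : M) : Prop :=
  is_function_on f A /\ forall x y, rel f x y -> y ∈ B.

Definition is_surjection (M : ZFA) (f A B : M) : Prop :=
  is_function f A B /\ forall y, y ∈ B -> exists x, rel f x y.

Definition is_injection (M : ZFA) (f A B : M) : Prop :=
  is_function f A B /\ forall x x' y, rel f x y -> rel f x' y -> x = x'.

Definition equinumerous (M : ZFA) (A B : M) : Prop :=
  exists f, is_injection f A B /\ is_surjection f A B.

(* |X| belongs to the class of cardinalities |Y| of the sets Y that do not surject onto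
   a proper superset. *)
Definition card_in_Delta5 (M : ZFA) (X : M) : Prop :=
  exists Y : M, is_set Y /\ equinumerous X Y /\
    ~ exists f Z, proper_subset Y Z /\ is_surjection f Y Z.

Definition partial_order (M : ZFA) (T R : M) : Prop :=
  is_set T /\ is_set R /\
  (forall p, p ∈ R -> exists x y, is_pair p x y /\ x ∈ T /\ y ∈ T) /\
  (forall x, x ∈ T -> rel R x x) /\
  (forall x y, rel R x y -> rel R y x -> x = y) /\
  (forall x y z, rel R x y -> rel R y z -> rel R x z).

Definition is_tree (M : ZFA) (T R : M) : Prop :=
  partial_order T R /\
  (forall x y, x ∈ T -> y ∈ T -> exists z, rel R z x /\ rel R z y) /\
  (forall x, x ∈ T -> forall y z, rel R y x -> rel R z x -> rel R y z \/ rel R z y).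

(* The last clause says that {y in T : y <= x}, which is linearly ordered in a tree,
   is well-ordered. *)
Definition well_founded_tree (M : ZFA) (T R : M) : Prop :=
  is_tree T R /\
  (exists! r, r ∈ T /\ forall y, y ∈ T -> rel R r y) /\
  (forall x, x ∈ T -> forall S, (exists y, y ∈ S) -> (forall y, y ∈ S -> rel R y x) ->
     exists m, m ∈ S /\ forall y, y ∈ S -> rel R m y).

Definition is_leaf (M : ZFA) (T R x : M) : Prop :=
  x ∈ T /\ forall y, rel R x y -> y = x.

(* Von Neumann ordinals.  Elements must be required to be sets: {a} with a an atom is
   transitive and well-ordered by membership. *)
Definition ordinal (M : ZFA) (a : M) : Prop :=
  is_set a /\
  (forall x, x ∈ a -> is_set x) /\
  (forall x y, x ∈ a -> y ∈ x -> y ∈ a) /\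
  (forall x, x ∈ a -> ~ x ∈ x) /\
  (forall x y z, x ∈ a -> y ∈ a -> z ∈ a -> x ∈ y -> y ∈ z -> x ∈ z) /\
  (forall x y, x ∈ a -> y ∈ a -> x ∈ y \/ x = y \/ y ∈ x) /\
  (forall S, (exists x, x ∈ S) -> (forall x, x ∈ S -> x ∈ a) ->
     exists m, m ∈ S /\ forall x, x ∈ S -> m ∈ x \/ m = x).

Definition ord_le (M : ZFA) (a b : M) : Prop := a ∈ b \/ a = b.

Definition limit_ordinal (M : ZFA) (a : M) : Prop :=
  ordinal a /\ (exists x, x ∈ a) /\ forall x, x ∈ a -> exists y, y ∈ a /\ x ∈ y.

Definition is_omega (M : ZFA) (w : M) : Prop :=
  limit_ordinal w /\ forall a, limit_ordinal a -> ord_le w a.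

(* x is in T but in no g(c) with c < b *)
Definition remaining (M : ZFA) (T g b x : M) : Prop :=
  x ∈ T /\ ~ exists c L, c ∈ b /\ rel g c L /\ x ∈ L.

(* L is the set of minimal elements of T minus the union of the g(c), c < b *)
Definition is_next_level (M : ZFA) (T R g b L : M) : Prop :=
  is_set L /\
  forall x, x ∈ L <->
    remaining T g b x /\ forall y, remaining T g b y -> rel R y x -> y = x.

(* g is the sequence of the levels L_b for b < a *)
Definition level_sequence (M : ZFA) (T R a g : M) : Prop :=
  is_function_on g a /\ forall b L, rel g b L -> is_next_level T R g b L.

(* L = L_a *)
Definition is_level (M : ZFA) (T R a L : M) : Prop :=
  ordinal a /\ exists g, level_sequence T R a g /\ is_next_level T R g a L.

Definition has_height (M : ZFA) (T R a : M) : Prop :=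
  is_level T R a (empty M) /\
  forall b, is_level T R b (empty M) -> ord_le a b.

(* Main.v *)
Require Import Defs.
From Stdlib Require Import Arith Classical.

Set Implicit Arguments.
Unset Strict Implicit.

(** Both directions reduce to one fact: [X] is outside Delta_5 exactly when [X] itself
    surjects onto a proper superset, since such a surjection can be carried along a
    bijection [X -> Y] once all values outside [X] are collapsed to one new point, for
    which the set [Y] serves ([not_Delta5_iff]).

    From a tree [T] to a surjection ([tree_surjection]): send each node to its immediate
    predecessor, the nodes that have none (such as the root) to a point outside [X], and
    fix the points of [X] outside [T].  A node [y] is a value because it is not a leaf:
    choose [z > y]; the least element of the nodes [u] with [y < u <= z] has [y] as
    immediate predecessor.

    From a surjection [f : X -> Z] to a tree ([surjection_tree]): choose a point [a] of
    [Z] outside [X] and [r] with [f r = a], let [T] be the set of points that reach [r]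
    under iteration of [f], and put [y <= x] when [y] is an iterate of [x].  The orbit of
    [r] leaves [X] at once, so a point reaches [r] after exactly one number of steps
    ([level_unique]); this number is its level, and passing to an iterate lowers it
    ([descends_level]).  Since [f] is onto, no level is empty and there are no leaves;
    since levels are natural numbers, the height is omega ([preimage_height]).

    All this takes place inside a first-order model, where separation and induction are
    available for definable predicates only.  The first part therefore proves that
    definability is closed under the logical connectives, with arbitrary parameters, so
    that a tactic can discharge it.  Recursion is avoided: iterates of [f] and levels are
    both given by reflexive transitive closures, defined by quantifying over the sets
    that are closed under the step relation.  Ordinals enter through two facts only:
    the intersection of all inductive sets is the least limit ordinal
    ([omega_is_omega]), and an ordinal that is not a natural number is at least omega
    ([ordinal_nat_or_ge_omega]).  The metatheory contributes excluded middle and nothing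
    else. *)

(** * Definability *)

(** A formula has one supply of variables, but two kinds of them are needed: free
    variables, which quantifiers shift, and parameters, which they do not.  Even indices
    are used for the former and odd ones for the latter. *)
Definition slot (i : nat + nat) : nat :=
  match i with inl i => i + i | inr j => S (j + j) end.

Fixpoint unslot (n : nat) : nat + nat :=
  match n with
  | 0 => inl 0
  | 1 => inr 0
  | S (S m) => match unslot m with inl i => inl (S i) | inr j => inr (S j) end
  end.

Lemma unslotK i : unslot (slot i) = i.
Proof.
assert (Hl : forall i, unslot (i + i) = inl i).
{ induction i0 as [|i0 IH]; [reflexivity|].
  rewrite Nat.add_succ_r; simpl; now rewrite IH. }
assert (Hr : forall i, unslot (S (i + i)) = inr i).
{ induction i0 as [|i0 IH]; [reflexivity|].
  rewrite Nat.add_succ_r; simpl in *; now rewrite IH. }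
destruct i; simpl; [apply Hl | apply Hr].
Qed.

Definition merge (V : Type) (s e : nat -> V) (n : nat) : V :=
  match unslot n with inl i => s i | inr j => e j end.

Lemma merge_l V (s e : nat -> V) i : merge s e (slot (inl i)) = s i.
Proof. unfold merge; now rewrite unslotK. Qed.

Lemma merge_r V (s e : nat -> V) i : merge s e (slot (inr i)) = e i.
Proof. unfold merge; now rewrite unslotK. Qed.

Definition up (r : nat -> nat) (n : nat) : nat :=
  match n with 0 => 0 | S m => S (r m) end.

Fixpoint rename (r : nat -> nat) (p : formula) : formula :=
  match p with
  | fMem i j => fMem (r i) (r j)
  | fEq i j => fEq (r i) (r j)
  | fFalse => fFalse
  | fImp p q => fImp (rename r p) (rename r q)
  | fAnd p q => fAnd (rename r p) (rename r q)
  | fOr p q => fOr (rename r p) (rename r q)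
  | fAll p => fAll (rename (up r) p)
  | fEx p => fEx (rename (up r) p)
  end.

(** Asking only for pointwise agreement of the assignments absorbs extensionality, and
    makes every change of variables below an instance. *)
Lemma sat_rename V (mem : V -> V -> Prop) p : forall r e e',
  (forall n, e' (r n) = e n) -> sat mem (rename r p) e' <-> sat mem p e.
Proof.
assert (Hup : forall r (e e' : nat -> V) x, (forall n, e' (r n) = e n) ->
  forall n, scons x e' (up r n) = scons x e n).
{ intros r e e' x H [|n]; simpl; auto. }
induction p as [i j|i j| |p IHp q IHq|p IHp q IHq|p IHp q IHq|p IHp|p IHp];
  intros r e e' H; simpl.
- now rewrite !H.
- now rewrite !H.
- tauto.
- now rewrite (IHp _ _ _ H), (IHq _ _ _ H).
- now rewrite (IHp _ _ _ H), (IHq _ _ _ H).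
- now rewrite (IHp _ _ _ H), (IHq _ _ _ H).
- split; intros K x; specialize (K x); now apply (IHp _ _ _ (Hup _ _ _ x H)).
- split; intros [x K]; exists x; now apply (IHp _ _ _ (Hup _ _ _ x H)).
Qed.

Section Definability.
Variable M : ZFA.
Implicit Types (s e : nat -> M) (P Q : (nat -> M) -> Prop) (t u : (nat -> M) -> M).

Definition definable P := exists p e, forall s,
  P s <-> sat (@mem M) p (merge s e).

(** Variables and parameters at once: the formulas have no function symbols, so these are
    the only terms. *)
Definition term t := exists n e, forall s, t s = merge s e n.

(** Substituting terms makes these notions stable under weakening: a predicate known to be
    definable may then be used under any number of quantifiers. *)
Definition definable1 (P : M -> Prop) :=
  forall t, term t -> definable (fun s => P (t s)).

Definition definable2 (P : M -> M -> Prop) :=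
  forall t u, term t -> term u -> definable (fun s => P (t s) (u s)).

Lemma term_var i : term (fun s => s i).
Proof. exists (slot (inl i)), (fun _ => empty M); intros s; now rewrite merge_l. Qed.

Lemma term_param c : term (fun _ => c).
Proof. exists (slot (inr 0)), (fun _ => c); intros s; now rewrite merge_r. Qed.

(** Needed under a quantifier, where a term is evaluated at the shifted assignment. *)
Lemma term_reindex t (r : nat -> nat) : term t -> term (fun s => t (fun n => s (r n))).
Proof.
intros [n [e H]].
exists (match unslot n with inl i => slot (inl (r i)) | inr j => slot (inr j) end), e.
intros s; rewrite H; unfold merge at 1.
destruct (unslot n); [now rewrite merge_l | now rewrite merge_r].
Qed.

(** Two formulas each come with their own infinite list of parameters; to combine them,
    the lists are interleaved by [merge] and the parameter indices are moved along. *)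
Definition widen (inj : nat -> nat) (n : nat) : nat :=
  match unslot n with
  | inl i => slot (inl i)
  | inr j => slot (inr (inj j))
  end.

Lemma merge_widen inj s e e' n :
  (forall j, e' (inj j) = e j) -> merge s e' (widen inj n) = merge s e n.
Proof.
intros H; unfold widen, merge at 2.
destruct (unslot n); [apply merge_l | now rewrite merge_r].
Qed.

Lemma merge_widen_l s e e' n :
  merge s (merge e e') (widen (fun j => slot (inl j)) n) = merge s e n.
Proof. apply merge_widen; apply merge_l. Qed.

Lemma merge_widen_r s e e' n :
  merge s (merge e e') (widen (fun j => slot (inr j)) n) = merge s e' n.
Proof. apply merge_widen; apply merge_r. Qed.

Lemma definable_atomic (c : nat -> nat -> formula) (A : M -> M -> Prop) :
  (forall i j e, sat (@mem M) (c i j) e <-> A (e i) (e j)) -> definable2 A.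
Proof.
intros Hc t u [n [e H]] [n' [e' H']].
exists (c (widen (fun j => slot (inl j)) n) (widen (fun j => slot (inr j)) n')), (merge e e').
intros s; rewrite Hc, merge_widen_l, merge_widen_r, H, H'; reflexivity.
Qed.

Lemma definable_mem : definable2 (@mem M).
Proof. apply (@definable_atomic fMem); intros; reflexivity. Qed.

Lemma definable_eq : definable2 (@eq M).
Proof. apply (@definable_atomic fEq); intros; reflexivity. Qed.

Lemma definable_connective (c : formula -> formula -> formula) (A : Prop -> Prop -> Prop) :
  (forall p q e, sat (@mem M) (c p q) e <-> A (sat (@mem M) p e) (sat (@mem M) q e)) ->
  (forall a a' b b', (a <-> a') -> (b <-> b') -> A a b <-> A a' b') ->
  forall P Q, definable P -> definable Q -> definable (fun s => A (P s) (Q s)).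
Proof.
intros Hc Hm P Q [p [e H]] [q [e' H']].
exists (c (rename (widen (fun j => slot (inl j))) p)
          (rename (widen (fun j => slot (inr j))) q)), (merge e e').
intros s; rewrite Hc; apply Hm.
- rewrite H; symmetry; apply sat_rename; intros n; apply merge_widen_l.
- rewrite H'; symmetry; apply sat_rename; intros n; apply merge_widen_r.
Qed.

Lemma definable_and P Q : definable P -> definable Q -> definable (fun s => P s /\ Q s).
Proof. apply (@definable_connective fAnd and); [reflexivity | tauto]. Qed.

Lemma definable_or P Q : definable P -> definable Q -> definable (fun s => P s \/ Q s).
Proof. apply (@definable_connective fOr or); [reflexivity | tauto]. Qed.

Lemma definable_imp P Q : definable P -> definable Q -> definable (fun s => P s -> Q s).
Proof.
apply (@definable_connective fImp (fun a b => a -> b)); [reflexivity | tauto].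
Qed.

Lemma definable_false : definable (fun _ => False).
Proof. exists fFalse, (fun _ => empty M); reflexivity. Qed.

Lemma definable_not P : definable P -> definable (fun s => ~ P s).
Proof. intros H; apply definable_imp; [exact H | apply definable_false]. Qed.

Lemma definable_iff P Q : definable P -> definable Q -> definable (fun s => P s <-> Q s).
Proof. intros; apply definable_and; now apply definable_imp. Qed.

(** Quantification over the free variable 0: de Bruijn binding puts the new value in front
    of both kinds of variables, whereas [definable] expects it in front of the free ones
    only. *)
Definition open (n : nat) : nat :=
  match unslot n with
  | inl 0 => 0
  | inl (S i) => S (slot (inl i))
  | inr j => S (slot (inr j))
  end.

Lemma merge_open x s e n :
  scons x (merge s e) (open n) = merge (scons x s) e n.
Proof.
unfold open, merge at 2.
destruct (unslot n) as [[|i]|j]; simpl scons;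
  [reflexivity | apply merge_l | apply merge_r].
Qed.

Lemma definable_all (Q : M -> (nat -> M) -> Prop) :
  definable (fun s => Q (s 0) (fun n => s (S n))) -> definable (fun s => forall x, Q x s).
Proof.
intros [p [e H]]; exists (fAll (rename open p)), e; intros s; simpl.
split; intros K x; specialize (K x).
- apply (sat_rename _ _ (merge_open x s e)), H, K.
- apply (sat_rename _ _ (merge_open x s e)), H in K; exact K.
Qed.

Lemma definable_ex (Q : M -> (nat -> M) -> Prop) :
  definable (fun s => Q (s 0) (fun n => s (S n))) -> definable (fun s => exists x, Q x s).
Proof.
intros [p [e H]]; exists (fEx (rename open p)), e; intros s; simpl.
split; intros [x K]; exists x.
- apply (sat_rename _ _ (merge_open x s e)), H, K.
- apply (sat_rename _ _ (merge_open x s e)), H in K; exact K.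
Qed.

End Definability.

Ltac is_term :=
  lazymatch goal with
  | |- term (fun _ => ?c) => apply term_param
  | |- term (fun s => s ?i) => apply term_var
  | |- term (fun s => ?t (fun n => s (@?r n))) => apply (@term_reindex _ t r); assumption
  | |- term _ => assumption
  end.

(** The defined notions that [definable] may expand; later definitions are added. *)
Ltac unfold_notions :=
  unfold is_set, subset, proper_subset, is_upair, is_pair, rel, unique.

Ltac definable :=
  cbv beta;
  lazymatch goal with
  | |- definable1 _ => intros ? ?; definable
  | |- definable2 _ => intros ? ? ? ?; definable
  | |- definable (fun s => @?P s /\ @?Q s) =>
      apply (@definable_and _ P Q); definable
  | |- definable (fun s => @?P s \/ @?Q s) =>
      apply (@definable_or _ P Q); definable
  | |- definable (fun s => @?P s <-> @?Q s) =>
      apply (@definable_iff _ P Q); definable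
  | |- definable (fun s => ~ @?P s) => apply (@definable_not _ P); definable
  | |- definable (fun s => @?P s -> @?Q s) =>
      apply (@definable_imp _ P Q); definable
  | |- definable (fun s => forall x, @?P s x) =>
      apply (@definable_all _ (fun x s => P s x)); definable
  | |- definable (fun s => exists x, @?P s x) =>
      apply (@definable_ex _ (fun x s => P s x)); definable
  | |- definable (fun s => @?t s ∈ @?u s) =>
      apply (@definable_mem _ t u); is_term
  | |- definable (fun s => @?t s = @?u s) =>
      apply (@definable_eq _ t u); is_term
  | H : definable1 ?P |- definable (fun s => ?P (@?t s)) => apply (H t); is_term
  | H : definable2 ?P |- definable (fun s => ?P (@?t s) (@?u s)) =>
      apply (H t u); is_term
  | |- definable _ => progress unfold_notions; definable
  end.

(** * Elementary set theory *)

Section SetTheory.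
Variable M : ZFA.
Implicit Types (x y z A B F X : M).

Lemma nonempty_is_set x z : z ∈ x -> is_set x.
Proof. intros H K; apply ax_atoms in K; now apply (proj2 K z). Qed.

Lemma empty_is_set : is_set (empty M).
Proof. intros K; apply ax_atoms in K; now destruct K. Qed.

Lemma set_ext x y : is_set x -> is_set y -> (forall z, z ∈ x <-> z ∈ y) -> x = y.
Proof. apply ax_extensionality. Qed.

(** The single free variable of the formula is the candidate element, so [open] turns
    its parameters into the environment that the axiom scheme expects. *)
Lemma separation (P : M -> Prop) A : definable1 P ->
  exists B, is_set B /\ forall z, z ∈ B <-> z ∈ A /\ P z.
Proof.
intros HP; destruct (HP _ (term_var M 0)) as [p [e H]].
destruct (ax_separation (rename open p) (merge (fun _ => empty M) e) A) as [B [HB K]].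
exists B; split; [exact HB|]; intros z; rewrite K.
rewrite (sat_rename _ _ (merge_open z (fun _ => empty M) e)), <- H; reflexivity.
Qed.

(** Foundation for [{x, y}]. *)
Lemma mem_asym x y : x ∈ y -> ~ y ∈ x.
Proof.
intros Hxy Hyx; destruct (ax_pairing x y) as [p Hp].
destruct (@ax_foundation M p) as [m [Hm K]]; [exists x; apply Hp; auto|].
apply Hp in Hm; destruct Hm as [->| ->].
- apply (K y); [apply Hp; auto | exact Hyx].
- apply (K x); [apply Hp; auto | exact Hxy].
Qed.

Lemma mem_irrefl x : ~ x ∈ x.
Proof. intros H; exact (mem_asym H H). Qed.

Lemma upair_unique p q x y : is_upair p x y -> is_upair q x y -> p = q.
Proof.
intros Hp Hq; apply set_ext.
- apply nonempty_is_set with x; apply Hp; auto.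
- apply nonempty_is_set with x; apply Hq; auto.
- intros z; rewrite (Hp z), (Hq z); reflexivity.
Qed.

Lemma pair_exists x y : exists p, is_pair p x y.
Proof.
destruct (ax_pairing x x) as [a Ha], (ax_pairing x y) as [b Hb].
destruct (ax_pairing a b) as [p Hp]; exists p; intros z; rewrite Hp.
split; intros [K|K]; subst; auto.
- left; now apply upair_unique with x x.
- right; now apply upair_unique with x y.
Qed.

Lemma pair_unique p q x y : is_pair p x y -> is_pair q x y -> p = q.
Proof.
intros Hp Hq; destruct (ax_pairing x x) as [a Ha].
apply set_ext.
- apply nonempty_is_set with a; apply Hp; auto.
- apply nonempty_is_set with a; apply Hq; auto.
- intros z; rewrite (Hp z), (Hq z); reflexivity.
Qed.

Lemma pair_inj p x y x' y' : is_pair p x y -> is_pair p x' y' -> x = x' /\ y = y'.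
Proof.
intros H H'.
destruct (ax_pairing x x) as [a Ha], (ax_pairing x y) as [b Hb].
destruct (ax_pairing x' x') as [a' Ha'], (ax_pairing x' y') as [b' Hb'].
assert (Ka : a ∈ p) by (apply H; auto).
assert (Kb : b ∈ p) by (apply H; auto).
assert (Ka' : a' ∈ p) by (apply H'; auto).
assert (Kb' : b' ∈ p) by (apply H'; auto).
assert (Hx : x = x').
{ assert (Hx' : x' ∈ a).
  { apply H' in Ka; destruct Ka as [K|K]; apply K; auto. }
  apply Ha in Hx'; destruct Hx'; auto. }
subst x'; split; [reflexivity|].
assert (Hy : y = x \/ y = y').
{ apply H' in Kb; destruct Kb as [K|K].
  - left; assert (L : y ∈ b) by (apply Hb; auto); apply K in L; tauto.
  - assert (L : y ∈ b) by (apply Hb; auto); now apply K in L. }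
assert (Hy' : y' = x \/ y' = y).
{ apply H in Kb'; destruct Kb' as [K|K].
  - left; assert (L : y' ∈ b') by (apply Hb'; auto); apply K in L; tauto.
  - assert (L : y' ∈ b') by (apply Hb'; auto); now apply K in L. }
destruct Hy as [Hy|Hy]; [|exact Hy].
destruct Hy' as [Hy'|Hy']; congruence.
Qed.

Lemma insert_exists A x : exists B, is_set B /\ forall z, z ∈ B <-> z ∈ A \/ z = x.
Proof.
destruct (ax_pairing x x) as [a Ha], (ax_pairing A a) as [q Hq].
destruct (ax_union q) as [B [HB K]]; exists B; split; [exact HB|].
intros z; rewrite K; split.
- intros [y [Hy Hz]]; apply Hq in Hy; destruct Hy as [->| ->]; [now left|].
  apply Ha in Hz; tauto.
- intros [Hz| ->]; [exists A | exists a]; (split; [apply Hq; auto|]); auto.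
  apply Ha; auto.
Qed.

(** Kuratowski pairs with entries in [W] belong to the double power set of [W], from which
    the graph can be separated. *)
Lemma relation_comprehension A B (P : M -> M -> Prop) : definable2 P ->
  exists F, is_set F /\
    (forall p, p ∈ F -> exists x y, is_pair p x y /\ x ∈ A /\ y ∈ B) /\
    (forall x y, rel F x y <-> x ∈ A /\ y ∈ B /\ P x y).
Proof.
intros HP.
destruct (ax_pairing A B) as [q Hq], (ax_union q) as [W [_ HW]].
destruct (ax_power W) as [PW HPW], (ax_power PW) as [PPW HPPW].
destruct (@separation
  (fun p => exists x y, is_pair p x y /\ x ∈ A /\ y ∈ B /\ P x y) PPW)
  as [F [HF K]].
{ definable. }
assert (HA : forall x, x ∈ A -> x ∈ W)
  by (intros x Hx; apply HW; exists A; split; [apply Hq|]; auto).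
assert (HB : forall x, x ∈ B -> x ∈ W)
  by (intros x Hx; apply HW; exists B; split; [apply Hq|]; auto).
exists F; split; [exact HF|]; split.
- intros p Hp; apply K in Hp; destruct Hp as [_ [x [y Hp]]].
  exists x, y; tauto.
- intros x y; split.
  + intros [p [Hp Hin]]; apply K in Hin; destruct Hin as [_ [x' [y' [Hp' Hin]]]].
    now destruct (pair_inj Hp Hp') as [-> ->].
  + intros Hxy; destruct (pair_exists x y) as [p Hp]; exists p; split; [exact Hp|].
    apply K; split; [|exists x, y; tauto].
    apply HPPW; split.
    * destruct (ax_pairing x x) as [a Ha].
      apply (@nonempty_is_set p a), Hp; now left.
    * intros z Hz; apply HPW; apply Hp in Hz; destruct Hz as [Hz|Hz]; split.
      1,3: apply (@nonempty_is_set z x), Hz; now left.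
      all: intros v Hv; apply Hz in Hv; destruct Hv as [->| ->]; [apply HA|..]; try tauto.
      all: first [apply HA; tauto | apply HB; tauto].
Qed.

End SetTheory.

(** * The natural numbers of the model *)

Section Naturals.
Variable M : ZFA.
Implicit Types (a b k m n w x y z : M).

Definition is_succ m n := forall z, z ∈ m <-> z ∈ n \/ z = n.

Definition inductive I := empty M ∈ I /\ forall x, x ∈ I -> exists y, y ∈ I /\ is_succ y x.

(** A predicate rather than a set omega, so that no choice of such a set has to be carried
    along; induction is built in. *)
Definition is_nat n := forall I, inductive I -> n ∈ I.

End Naturals.

Ltac unfold_notions ::=
  unfold is_set, subset, proper_subset, is_upair, is_pair, rel, unique,
    is_succ, is_nat, inductive.

Section NaturalsTheory.
Variable M : ZFA.
Implicit Types (a b k m n w x y z : M).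

Lemma succ_is_set m n : is_succ m n -> is_set m.
Proof. intros H; apply (@nonempty_is_set M m n), H; auto. Qed.

Lemma succ_unique m m' n : is_succ m n -> is_succ m' n -> m = m'.
Proof.
intros H H'; apply set_ext; [exact (succ_is_set H) | exact (succ_is_set H') |].
intros z; rewrite (H z), (H' z); reflexivity.
Qed.

Lemma succ_exists n : exists m, is_succ m n.
Proof. destruct (insert_exists n n) as [m [_ H]]; exists m; exact H. Qed.

Lemma succ_inj m n k : is_succ m n -> is_succ m k -> n = k.
Proof.
intros H H'.
assert (Hn : n ∈ k \/ n = k) by (apply H', H; auto).
assert (Hk : k ∈ n \/ k = n) by (apply H, H'; auto).
destruct Hn as [Hn|]; [|assumption]; destruct Hk as [Hk|]; [|auto].
destruct (mem_asym Hn Hk).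
Qed.

Lemma nat_zero : is_nat (empty M).
Proof. intros I HI; apply HI. Qed.

Lemma nat_succ m n : is_succ m n -> is_nat n -> is_nat m.
Proof.
intros Hm Hn I HI; destruct (proj2 HI n (Hn I HI)) as [y [Hy Hs]].
now rewrite (succ_unique Hm Hs).
Qed.

Lemma omega_exists : exists w, is_set w /\ forall n, n ∈ w <-> is_nat n.
Proof.
destruct (ax_infinity M) as [w0 Hw0].
destruct (@separation M (@is_nat M) w0) as [w [Hw K]]; [definable|].
exists w; split; [exact Hw|]; intros n; rewrite K; split; [tauto|].
intros Hn; split; [apply Hn, Hw0 | exact Hn].
Qed.

Lemma nat_induction (P : M -> Prop) : definable1 P -> P (empty M) ->
  (forall m n, is_nat n -> P n -> is_succ m n -> P m) -> forall n, is_nat n -> P n.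
Proof.
intros HP H0 HS n Hn.
destruct omega_exists as [w [_ Hw]], (@separation M P w HP) as [I [_ HI]].
apply (HI n), Hn; split; [apply HI; split; [apply Hw, nat_zero | exact H0]|].
intros x Hx; apply HI in Hx; destruct Hx as [Hx HPx]; apply Hw in Hx.
destruct (succ_exists x) as [y Hy]; exists y; split; [|exact Hy].
apply HI; split; [apply Hw, (nat_succ Hy Hx) | exact (HS y x Hx HPx Hy)].
Qed.

Lemma nat_cases n : is_nat n -> n = empty M \/ exists k, is_nat k /\ is_succ n k.
Proof.
intros Hn; revert n Hn; refine (nat_induction _ _ _); [definable | now left|].
intros m n Hn _ Hm; right; exists n; auto.
Qed.

Lemma nat_is_set n : is_nat n -> is_set n.
Proof.
intros Hn; destruct (nat_cases Hn) as [-> | [k [_ Hk]]];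
  [apply empty_is_set | exact (succ_is_set Hk)].
Qed.

Lemma nat_mem_nat n : is_nat n -> forall k, k ∈ n -> is_nat k.
Proof.
revert n; refine (nat_induction _ _ _); [definable | |].
- intros k Hk; destruct (ax_empty Hk).
- intros m n Hn IH Hm k Hk; apply Hm in Hk; destruct Hk as [Hk| ->]; auto.
Qed.

Lemma nat_transitive n : is_nat n -> forall x y, x ∈ y -> y ∈ n -> x ∈ n.
Proof.
revert n; refine (nat_induction _ _ _); [definable | |].
- intros x y _ Hy; destruct (ax_empty Hy).
- intros m n Hn IH Hm x y Hx Hy; apply Hm in Hy; apply Hm; left.
  destruct Hy as [Hy| ->]; [exact (IH x y Hx Hy) | exact Hx].
Qed.

Lemma zero_le_nat n : is_nat n -> empty M ∈ n \/ empty M = n.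
Proof.
revert n; refine (nat_induction _ _ _); [definable | now right |].
intros m n _ IH Hm; left; apply Hm; tauto.
Qed.

Lemma succ_le_of_mem n : is_nat n -> forall k m, k ∈ n -> is_succ m k -> m ∈ n \/ m = n.
Proof.
revert n; refine (nat_induction _ _ _); [definable | |].
- intros k m Hk; destruct (ax_empty Hk).
- intros n' n _ IH Hn' k m Hk Hm; apply Hn' in Hk; destruct Hk as [Hk| ->].
  + left; apply Hn', (IH k m Hk Hm).
  + right; exact (succ_unique Hm Hn').
Qed.

Lemma nat_trichotomy n : is_nat n -> forall m, is_nat m -> n ∈ m \/ n = m \/ m ∈ n.
Proof.
revert n; refine (nat_induction _ _ _); [definable | |].
- intros m Hm; destruct (zero_le_nat Hm); auto.
- intros n' n Hn IH Hn' m Hm; destruct (IH m Hm) as [K|[->|K]].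
  + destruct (succ_le_of_mem Hm K Hn'); auto.
  + right; right; apply Hn'; auto.
  + right; right; apply Hn'; auto.
Qed.

(** Trichotomy turns an element that is minimal for membership, as given by foundation,
    into a least one. *)
Lemma omega_ordinal w : is_set w -> (forall n, n ∈ w <-> is_nat n) -> ordinal w.
Proof.
intros Hset Hw; repeat split.
- exact Hset.
- intros x Hx; apply nat_is_set, Hw, Hx.
- intros x y Hx Hy; apply Hw in Hx; apply Hw, (nat_mem_nat Hx Hy).
- intros x _; apply mem_irrefl.
- intros x y z _ _ Hz Hxy Hyz; apply Hw in Hz; exact (nat_transitive Hz Hxy Hyz).
- intros x y Hx Hy; apply Hw in Hx, Hy; now apply nat_trichotomy.
- intros S HS HSw; destruct (ax_foundation HS) as [m [Hm K]].
  exists m; split; [exact Hm|]; intros x Hx.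
  assert (Hm' := HSw m Hm); assert (Hx' := HSw x Hx); apply Hw in Hm', Hx'.
  destruct (nat_trichotomy Hm' Hx') as [L|[L|L]]; auto.
  destruct (K x Hx L).
Qed.

(** A proper transitive subset of an ordinal equals the least element of its complement. *)
Lemma ordinal_initial_segment a b : ordinal a -> is_set b ->
  (forall x, x ∈ b -> x ∈ a) -> (forall x y, x ∈ b -> y ∈ x -> y ∈ b) -> ord_le b a.
Proof.
intros [Ha [Hsets [Htr [_ [_ [Htri _]]]]]] Hb Hba Hbtr.
destruct (@separation M (fun x => ~ x ∈ b) a) as [D [_ HD]]; [definable|].
destruct (classic (exists x, x ∈ D)) as [HDne|HDe].
- left; destruct (ax_foundation HDne) as [m [Hm K]]; apply HD in Hm.
  destruct Hm as [Hma Hmb].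
  replace b with m; [exact Hma|]; apply set_ext; auto.
  intros z; split; intros Hz.
  + apply NNPP; intros Hzb; apply (K z); [apply HD; split|]; auto.
    exact (Htr m z Hma Hz).
  + destruct (Htri z m (Hba z Hz) Hma) as [L|[L|L]]; [exact L| |]; exfalso; apply Hmb.
    * now rewrite <- L.
    * exact (Hbtr z m Hz L).
- right; apply set_ext; auto; intros z; split; [apply Hba|].
  intros Hz; apply NNPP; intros Hzb; apply HDe; exists z; now apply HD.
Qed.

(** The least element of a limit ordinal is empty, and the least of its elements above [x]
    is the successor of [x]; hence every limit ordinal contains all natural numbers. *)
Lemma limit_ordinal_inductive a : limit_ordinal a -> inductive a.
Proof.
intros [[_ [Hsets [Htr [_ [Htrans [Htri _]]]]]] [Hne Hlim]]; split.
- destruct (ax_foundation Hne) as [m [Hm K]].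
  replace (empty M) with m; [exact Hm|]; apply set_ext; auto using empty_is_set.
  intros z; split; intros Hz; [|destruct (ax_empty Hz)].
  destruct (K z (Htr m z Hm Hz) Hz).
- intros x Hx.
  destruct (@separation M (fun y => x ∈ y) a) as [D [_ HD]]; [definable|].
  destruct (@ax_foundation M D) as [m [Hm K]].
  { destruct (Hlim x Hx) as [y Hy]; exists y; now apply HD. }
  apply HD in Hm; destruct Hm as [Hm Hxm]; exists m; split; [exact Hm|].
  intros z; split.
  + intros Hz; assert (Hza := Htr m z Hm Hz).
    destruct (Htri z x Hza Hx) as [L|[L|L]]; auto.
    destruct (K z); [now apply HD | exact Hz].
  + intros [Hz| ->]; [|exact Hxm].
    exact (Htrans z x m (Htr x z Hx Hz) Hx Hm Hz Hxm).
Qed.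

Lemma omega_le_ordinal w b : is_set w -> (forall n, n ∈ w <-> is_nat n) -> ordinal b ->
  (forall n, is_nat n -> n ∈ b) -> ord_le w b.
Proof.
intros Hset Hw Hb H; apply ordinal_initial_segment; auto.
- intros x Hx; apply H, Hw, Hx.
- intros x y Hx Hy; apply Hw in Hx; apply Hw, (nat_mem_nat Hx Hy).
Qed.

Lemma omega_is_omega w : is_set w -> (forall n, n ∈ w <-> is_nat n) -> is_omega w.
Proof.
intros Hset Hw; split.
- split; [exact (omega_ordinal Hset Hw)|]; split.
  + exists (empty M); apply Hw, nat_zero.
  + intros x Hx; apply Hw in Hx; destruct (succ_exists x) as [y Hy].
    exists y; split; [apply Hw, (nat_succ Hy Hx) | apply Hy; auto].
- intros a Ha; apply omega_le_ordinal; auto; [apply Ha|].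
  intros n Hn; apply Hn, limit_ordinal_inductive, Ha.
Qed.

(** The least natural number missing from [b] is an initial segment of [b] that is not an
    element of it, hence [b] itself. *)
Lemma ordinal_nat_or_ge_omega w b : is_set w -> (forall n, n ∈ w <-> is_nat n) ->
  ordinal b -> is_nat b \/ ord_le w b.
Proof.
intros Hset Hw Hb.
destruct (@separation M (fun x => ~ x ∈ b) w) as [D [_ HD]]; [definable|].
destruct (classic (exists x, x ∈ D)) as [HDne|HDe].
- left; destruct (ax_foundation HDne) as [m [Hm K]]; apply HD in Hm.
  destruct Hm as [Hmw Hmb]; apply Hw in Hmw.
  destruct (@ordinal_initial_segment b m) as [L|L]; auto using nat_is_set.
  + intros x Hx; apply NNPP; intros Hxb; apply (K x); [apply HD; split|]; auto.
    apply Hw, (nat_mem_nat Hmw Hx).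
  + intros x y Hx Hy; exact (nat_transitive Hmw Hy Hx).
  + contradiction.
  + now rewrite <- L.
- right; apply omega_le_ordinal; auto.
  intros n Hn; apply NNPP; intros Hnb; apply HDe; exists n; apply HD; split; auto.
  now apply Hw.
Qed.

End NaturalsTheory.

(** * Reflexive transitive closures *)

(** The second-order definition of the closure, with sets of the model in place of
    predicates: it is a first-order formula as soon as [step] is, and no natural numbers
    are involved.  It is meaningful only if some set contains [u] and is closed under
    [step], which is the purpose of the set [U] in the lemmas below. *)
Definition star (M : ZFA) (step : M -> M -> Prop) (u v : M) : Prop :=
  forall S : M, u ∈ S -> (forall a b, a ∈ S -> step a b -> b ∈ S) -> v ∈ S.

Ltac unfold_notions ::=
  unfold is_set, subset, proper_subset, is_upair, is_pair, rel, unique,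
    is_succ, is_nat, inductive, star.

Section Star.
Variables (M : ZFA) (step : M -> M -> Prop).
Implicit Types u v x : M.

Lemma star_refl u : star step u u.
Proof. intros S Hu _; exact Hu. Qed.

Lemma star_right u v x : star step u v -> step v x -> star step u x.
Proof. intros Huv Hvx S Hu HS; exact (HS v x (Huv S Hu HS) Hvx). Qed.

Lemma star_trans u v x : star step u v -> star step v x -> star step u x.
Proof. intros Huv Hvx S Hu HS; exact (Hvx S (Huv S Hu HS) HS). Qed.

Lemma star_left u v x : step u v -> star step v x -> star step u x.
Proof. intros Huv; apply star_trans, star_right with u; [apply star_refl | exact Huv]. Qed.

Variable U : M.
Hypothesis step_definable : definable2 step.
Hypothesis U_closed : forall a b, a ∈ U -> step a b -> b ∈ U.

Lemma star_induction (P : M -> Prop) u : definable1 P -> u ∈ U -> P u ->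
  (forall a b, star step u a -> P a -> step a b -> P b) ->
  forall v, star step u v -> P v.
Proof.
intros HP HuU Hu Hstep v Huv.
destruct (@separation M (fun x => P x /\ star step u x) U) as [S [_ HS]]; [definable|].
apply (HS v), Huv.
- apply HS; auto using star_refl.
- intros a b Ha Hab; apply HS in Ha; destruct Ha as [HaU [HPa Ha]]; apply HS.
  split; [exact (U_closed HaU Hab)|]; split; [exact (Hstep a b Ha HPa Hab)|].
  exact (star_right Ha Hab).
Qed.

Lemma star_last_step u v : u ∈ U -> star step u v ->
  v = u \/ exists x, star step u x /\ step x v.
Proof.
intros Hu; revert v; refine (star_induction _ _ _ _);
  [definable | exact Hu | now left |].
intros a b Ha _ Hab; right; exists a; auto.
Qed.

Lemma star_first_step u v : u ∈ U -> star step u v ->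
  v = u \/ exists x, step u x /\ star step x v.
Proof.
intros Hu; revert v; refine (star_induction _ _ _ _);
  [definable | exact Hu | now left |].
intros a b Ha [->|[x [Hux Hxa]]] Hab; right.
- exists b; auto using star_refl.
- exists x; split; [exact Hux | exact (star_right Hxa Hab)].
Qed.

End Star.

(** * Surjections onto proper supersets *)

Section Surjections.
Variable M : ZFA.
Implicit Types (A B F R T X Y Z f x y : M).

Lemma function_comprehension A B (P : M -> M -> Prop) : definable2 P ->
  (forall x, x ∈ A -> exists! y, y ∈ B /\ P x y) ->
  exists F, is_function F A B /\ forall x y, rel F x y <-> x ∈ A /\ y ∈ B /\ P x y.
Proof.
intros HP Huniq; destruct (relation_comprehension A B HP) as [F [HF [Hp HFr]]].
exists F; split; [|exact HFr]; split; [split; [exact HF|split]|].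
- intros p Hin; destruct (Hp p Hin) as [x [y Hxy]]; exists x, y; tauto.
- intros x Hx; destruct (Huniq x Hx) as [y [Hy Hy']]; exists y; split.
  + apply HFr; tauto.
  + intros y' Hxy'; apply HFr in Hxy'; apply Hy'; tauto.
- intros x y Hxy; apply HFr in Hxy; tauto.
Qed.

Lemma function_dom f A x y : is_function_on f A -> rel f x y -> x ∈ A.
Proof.
intros [_ [H _]] [p [Hp Hin]]; destruct (H p Hin) as [x' [y' [Hp' Hx']]].
now destruct (pair_inj Hp Hp') as [-> _].
Qed.

Lemma function_unique f A x y y' : is_function_on f A -> rel f x y -> rel f x y' -> y = y'.
Proof.
intros Hf Hy Hy'; destruct (proj2 (proj2 Hf) x (function_dom Hf Hy)) as [z [_ Hz]].
now rewrite <- (Hz y Hy), <- (Hz y' Hy').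
Qed.

Lemma equinumerous_refl X : equinumerous X X.
Proof.
destruct (@function_comprehension X X (fun x y => y = x)) as [F [HF K]].
- definable.
- intros x Hx; exists x; split; [auto | intuition].
- exists F; split; (split; [exact HF|]).
  + intros x x' y Hx Hx'; apply K in Hx, Hx'; destruct Hx as [_ [_ ->]]; tauto.
  + intros y Hy; exists y; apply K; auto.
Qed.

Lemma proper_subset_point X Z : proper_subset X Z -> exists a, a ∈ Z /\ ~ a ∈ X.
Proof.
intros [[HX [HZ HXZ]] Hne]; apply NNPP; intros K; apply Hne, set_ext; auto.
intros z; split; [apply HXZ|]; intros Hz; apply NNPP; intros Hz'; apply K; exists z; auto.
Qed.

(** The content is the transport along a bijection [h : X -> Y].  Values of [f] in [X] are
    moved by [h]; all the others go to [Y], which is not one of its own elements. *)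
Lemma not_Delta5_iff X : is_set X -> ~ card_in_Delta5 X <->
  exists f Z, proper_subset X Z /\ is_surjection f X Z.
Proof.
intros HX; split.
- intros H; apply NNPP; intros K; apply H; exists X; auto using equinumerous_refl.
- intros [f [Z [HXZ [[Hf _] Hfs]]]].
  intros [Y [HY [[h [[[Hh HhY] Hhi] [_ Hhs]]] Hno]]]; apply Hno; clear Hno.
  (* By foundation [Y] is not an element of [Y], so this adds a point. *)
  destruct (insert_exists Y Y) as [Y' [HY' KY']].
  destruct (proper_subset_point HXZ) as [a [HaZ HaX]].
  destruct (@function_comprehension Y Y' (fun u v => exists x z,
    rel h x u /\ rel f x z /\ (rel h z v \/ ~ z ∈ X /\ v = Y))) as [F [HF KF]].
  + definable.
  + intros u Hu; destruct (Hhs u Hu) as [x Hx]; assert (HxX := function_dom Hh Hx).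
    destruct (proj2 (proj2 Hf) x HxX) as [z [Hz _]].
    assert (Huniq : forall x' z', rel h x' u -> rel f x' z' -> z' = z).
    { intros x' z' Hx' Hz'; rewrite (Hhi _ _ _ Hx' Hx) in Hz'.
      exact (function_unique Hf Hz' Hz). }
    destruct (classic (z ∈ X)) as [HzX|HzX].
    * destruct (proj2 (proj2 Hh) z HzX) as [v [Hv _]]; exists v; split.
      -- split; [apply KY'; left; exact (HhY _ _ Hv)|]; exists x, z; auto.
      -- intros v' [_ [x' [z' [Hx' [Hz' K]]]]]; rewrite (Huniq x' z' Hx' Hz') in K.
         destruct K as [K|[K _]]; [exact (function_unique Hh Hv K) | contradiction].
    * exists Y; split.
      -- split; [apply KY'; auto|]; exists x, z; auto.
      -- intros v' [_ [x' [z' [Hx' [Hz' K]]]]]; rewrite (Huniq x' z' Hx' Hz') in K.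
         destruct K as [K|[_ K]]; [destruct (HzX (function_dom Hh K)) | auto].
  + exists F, Y'; split; [split|split].
    * split; [exact HY | split; [exact HY'|]]; intros z Hz; apply KY'; auto.
    * intros E; apply (@mem_irrefl M Y); rewrite E at 2; apply KY'; auto.
    * exact HF.
    * intros v Hv.
      assert (Hz : exists z, z ∈ Z /\ (rel h z v \/ ~ z ∈ X /\ v = Y)).
      { apply KY' in Hv; destruct Hv as [Hv| ->].
        - destruct (Hhs v Hv) as [z Hz]; exists z; split; auto.
          apply HXZ, (function_dom Hh Hz).
        - exists a; auto. }
      destruct Hz as [z [HzZ Hz]], (Hfs z HzZ) as [x Hx].
      destruct (proj2 (proj2 Hh) x (function_dom Hf Hx)) as [u [Hu _]].
      exists u; apply KF; split; [exact (HhY _ _ Hu)|]; split; [exact Hv|].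
      exists x, z; auto.
Qed.

Lemma partial_order_field T R x y : partial_order T R -> rel R x y -> x ∈ T /\ y ∈ T.
Proof.
intros [_ [_ [H _]]] [p [Hp Hin]]; destruct (H p Hin) as [x' [y' [Hp' Hxy]]].
now destruct (pair_inj Hp Hp') as [-> ->].
Qed.

Definition immediate_pred R x y :=
  rel R x y /\ x <> y /\ forall z, rel R z y -> z = y \/ rel R z x.

(** Comparability of the nodes below [x] makes the immediate predecessor unique.  The
    extra point is [X] itself; besides the root it may have limit nodes as preimages. *)
Lemma tree_surjection X T R : is_set X -> subset T X -> well_founded_tree T R ->
  (~ exists x, is_leaf T R x) -> exists f Z, proper_subset X Z /\ is_surjection f X Z.
Proof.
intros HX [HT [_ HTX]] [[Hpo [_ Hlin]] [[r [[HrT Hr] _]] Hwf]] Hleaf.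
assert (Hfield := fun x y => @partial_order_field T R x y Hpo).
destruct Hpo as [_ [_ [_ [Hrefl [Hanti Htrans]]]]].
assert (Hpred : forall x x' y, immediate_pred R x y -> immediate_pred R x' y -> x = x').
{ intros x x' y [H1 [H2 H3]] [H1' [H2' H3']]; apply Hanti.
  - destruct (H3' x H1); [contradiction | assumption].
  - destruct (H3 x' H1'); [contradiction | assumption]. }
(* By foundation [X] is not an element of [X], so this adds a point. *)
destruct (insert_exists X X) as [Z [HZ KZ]].
destruct (@function_comprehension X Z (fun x y =>
  (~ x ∈ T /\ y = x) \/ (x ∈ T /\ immediate_pred R y x) \/
  (x ∈ T /\ (~ exists x', immediate_pred R x' x) /\ y = X))) as [F [HF KF]].
{ unfold immediate_pred; definable. }
{ intros x Hx; destruct (classic (x ∈ T)) as [HxT|HxT];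
    [destruct (classic (exists x', immediate_pred R x' x)) as [[y Hy]|Hy]|].
  - exists y; split.
    + split; [|auto]; apply KZ; left; apply HTX, (Hfield y x), Hy.
    + intros y' [_ [K|[K|K]]]; [tauto | apply (Hpred y y' x); tauto |].
      destruct K as [_ [K _]]; destruct K; now exists y.
  - exists X; split; [split; [apply KZ; auto | auto]|].
    intros y' [_ [K|[K|K]]]; [tauto | | symmetry; tauto].
    destruct Hy; exists y'; tauto.
  - exists x; split; [split; [apply KZ; auto | auto] |].
    intros y' [_ [K|[K|K]]]; [symmetry; tauto | tauto | tauto]. }
exists F, Z; split; [split|split].
- split; [exact HX | split; [exact HZ|]]; intros z Hz; apply KZ; auto.
- intros E; apply (@mem_irrefl M X); rewrite E at 2; apply KZ; auto.
- exact HF.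
- intros y Hy; assert (Hy' := Hy); apply KZ in Hy'.
  destruct (classic (y ∈ T)) as [HyT|HyT]; [|destruct Hy' as [HyX| ->]].
  (* [y] is the image of the least node [m] with [y < m <= z]. *)
  + assert (Hz : exists z, rel R y z /\ z <> y).
    { apply NNPP; intros K; apply Hleaf; exists y; split; [exact HyT|].
      intros z Hz; apply NNPP; intros Hzy; apply K; exists z; auto. }
    destruct Hz as [z [Hyz Hzy]].
    destruct (@separation M (fun u => rel R y u /\ u <> y /\ rel R u z) T) as [S [_ HS]];
      [definable|].
    assert (HzT : z ∈ T) by apply (Hfield y z Hyz).
    destruct (Hwf z HzT S) as [m [HmS Hm]].
    { exists z; apply HS; auto. }
    { intros u Hu; apply HS in Hu; tauto. }
    apply HS in HmS; destruct HmS as [HmT [Hym [Hmy Hmz]]].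
    exists m; apply KF; split; [auto|]; split; [exact Hy|]; right; left.
    split; [exact HmT|]; split; [exact Hym|]; split; [congruence|].
    intros u Hum; destruct (Hlin m HmT u y Hum Hym) as [K|K]; [auto|].
    destruct (classic (u = y)) as [->|Huy]; [auto|]; left.
    apply Hanti; [exact Hum|]; apply Hm, HS.
    split; [apply (Hfield u m Hum)|]; eauto.
  + exists y; apply KF; auto.
  + exists r; apply KF; split; [auto|]; split; [exact Hy|]; right; right.
    split; [exact HrT|]; split; [|reflexivity]; intros [x' [K [Hne _]]].
    apply Hne, Hanti; [exact K|]; apply Hr, (Hfield x' r K).
Qed.

End Surjections.

(** * The tree of iterated preimages of a point *)

(** Restricting to values in [X] makes [X] closed under the step, as [star_induction]
    requires, and stops the descent at the points that [f] sends outside [X]. *)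
Definition parent (M : ZFA) (f X x y : M) : Prop := rel f x y /\ y ∈ X.

(** One step of the recursion that defines levels, from [x] at level [n] to a preimage of
    [x] at level [n + 1]. *)
Definition climb (M : ZFA) (f X p q : M) : Prop :=
  exists n x m y, is_pair p n x /\ is_pair q m y /\
    is_nat n /\ is_succ m n /\ rel f y x /\ y ∈ X.

Definition iterated_preimage (M : ZFA) (f X r n x : M) : Prop :=
  exists p q, is_pair p (empty M) r /\ is_pair q n x /\ star (climb f X) p q.

Ltac unfold_notions ::=
  unfold is_set, subset, proper_subset, is_upair, is_pair, rel, unique,
    is_succ, is_nat, inductive, star, parent, climb, iterated_preimage.

Section PreimageTree.
Variables (M : ZFA) (X f r a : M).
Hypothesis f_dom : forall x y, rel f x y -> x ∈ X.
Hypothesis f_unique : forall x y y', rel f x y -> rel f x y' -> y = y'.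
Hypothesis f_onto : forall y, y ∈ X -> exists x, rel f x y.
Hypothesis r_in_X : r ∈ X.
Hypothesis f_r : rel f r a.
Hypothesis a_notin_X : ~ a ∈ X.

Notation descends := (star (parent f X)).
Notation level := (iterated_preimage f X r).

(** Inversion of the closure, for which the set of pairs [(n, x)] with [n] a natural number
    and [x] in [X] is the closed set needed. *)
Lemma level_inv n x : level n x -> (n = empty M /\ x = r) \/
  exists k y, is_nat k /\ is_succ n k /\ level k y /\ rel f x y.
Proof.
intros [p [q [Hp [Hq Hpq]]]].
destruct (omega_exists M) as [w [_ Hw]].
destruct (@relation_comprehension M w X (fun n _ => n = n)) as [U [_ [_ HU]]];
  [definable|].
assert (HpairU : forall p n x, is_pair p n x -> is_nat n -> x ∈ X -> p ∈ U).
{ intros p' n' x' Hp' Hn' Hx'; assert (K : rel U n' x') by (apply HU; split; [now apply Hw | auto]).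
  destruct K as [p'' [Hp'' Hin]]; now rewrite (pair_unique Hp' Hp''). }
destruct (@star_last_step M (climb f X) U) with (u := p) (v := q) as [E|[p' [Hpp' Hstep]]];
  [definable | | | exact Hpq | |].
- intros p1 p2 _ [n' [x' [m' [y' [_ [H2 [Hn [Hm [_ Hy]]]]]]]]].
  exact (HpairU _ _ _ H2 (nat_succ Hm Hn) Hy).
- exact (HpairU _ _ _ Hp (@nat_zero M) r_in_X).
- left; subst q; exact (pair_inj Hq Hp).
- right; destruct Hstep as [k [y [m [x' [Hp' [Hq' [Hk [Hm [Hf _]]]]]]]]].
  destruct (pair_inj Hq Hq') as [-> ->]; exists k, y; split; [exact Hk|].
  split; [exact Hm|]; split; [exists p, p'; auto | exact Hf].
Qed.

Lemma level_zero : level (empty M) r.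
Proof. destruct (pair_exists (empty M) r) as [p Hp]; exists p, p; auto using star_refl. Qed.

Lemma level_succ n k x y : is_nat k -> is_succ n k -> level k y -> rel f x y -> level n x.
Proof.
intros Hk Hn [p [q [Hp [Hq Hpq]]]] Hxy; destruct (pair_exists n x) as [q' Hq'].
exists p, q'; split; [exact Hp|]; split; [exact Hq'|]; apply star_right with q; auto.
exists k, y, n, x; do 5 (split; [assumption|]); exact (f_dom Hxy).
Qed.

Lemma level_nat n x : level n x -> is_nat n.
Proof.
intros H; destruct (level_inv H) as [[-> _]|[k [y [Hk [Hn _]]]]];
  [apply nat_zero | exact (nat_succ Hn Hk)].
Qed.

Lemma level_in_X n x : level n x -> x ∈ X.
Proof.
intros H; destruct (level_inv H) as [[_ ->]|[k [y [_ [_ [_ Hf]]]]]];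
  [exact r_in_X | exact (f_dom Hf)].
Qed.

(** A positive level would give [f r] in [X], whereas [f r = a]. *)
Lemma level_root n : level n r -> n = empty M.
Proof.
intros H; destruct (level_inv H) as [[-> _]|[k [y [_ [_ [Hy Hf]]]]]]; [reflexivity|].
destruct a_notin_X; rewrite (f_unique f_r Hf); exact (level_in_X Hy).
Qed.

Lemma level_parent n x y : level n x -> parent f X x y ->
  exists k, is_nat k /\ is_succ n k /\ level k y.
Proof.
intros H [Hf Hy]; destruct (level_inv H) as [[_ ->]|[k [y' [Hk [Hn [Hy' Hf']]]]]].
- destruct a_notin_X; now rewrite (f_unique f_r Hf).
- rewrite (f_unique Hf Hf'); exists k; auto.
Qed.

(** By induction, as [f] lowers every level of a point by one, until [r] is reached; the
    orbit of [r] leaves [X], so it never comes back to [r]. *)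
Lemma level_unique n : is_nat n -> forall m x, level n x -> level m x -> n = m.
Proof.
revert n; refine (nat_induction _ _ _); [definable | |].
- intros m x H0 Hm; destruct (level_inv H0) as [[_ ->]|[k [_ [_ [Hk _]]]]].
  + symmetry; exact (level_root Hm).
  + destruct (@ax_empty M k); apply Hk; auto.
- intros n' n Hn IH Hn' m x Hx Hm.
  destruct (level_inv Hx) as [[_ ->]|[k [y [Hk [Hk' [Hy Hf]]]]]].
  + now rewrite (level_root Hx), (level_root Hm).
  + destruct (level_parent Hm (conj Hf (level_in_X Hy))) as [j [Hj [Hmj Hjy]]].
    rewrite <- (succ_inj Hn' Hk') in Hy; rewrite <- (IH j y Hy Hjy) in Hmj.
    exact (succ_unique Hn' Hmj).
Qed.

Lemma level_nonempty n : is_nat n -> exists x, level n x.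
Proof.
revert n; refine (nat_induction _ _ _); [definable | exists r; exact level_zero |].
intros m n Hn [y Hy] Hm; destruct (f_onto (level_in_X Hy)) as [x Hx].
exists x; exact (level_succ Hn Hm Hy Hx).
Qed.

Lemma parent_definable : definable2 (parent f X).
Proof. definable. Qed.

Lemma parent_closed x y : x ∈ X -> parent f X x y -> y ∈ X.
Proof. intros _ H; apply H. Qed.

(** The source of antisymmetry and well-foundedness: proper iterates have smaller level. *)
Lemma descends_level n x y : level n x -> descends x y ->
  y = x \/ exists m, level m y /\ m ∈ n.
Proof.
intros Hx; revert y.
refine (star_induction parent_definable parent_closed _ (level_in_X Hx) _ _);
  [definable | now left |].
intros y z _ Hy Hyz; right; destruct Hy as [->|[m [Hm Hmn]]].
- destruct (level_parent Hx Hyz) as [k [_ [Hk Hz]]]; exists k.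
  split; [exact Hz | apply Hk; auto].
- destruct (level_parent Hm Hyz) as [k [_ [Hk Hz]]]; exists k; split; [exact Hz|].
  apply (nat_transitive (level_nat Hx)) with m; [apply Hk; auto | exact Hmn].
Qed.

Lemma descends_to_root n : is_nat n -> forall x, level n x -> descends x r.
Proof.
revert n; refine (nat_induction _ _ _); [definable | |].
- intros x Hx; destruct (level_inv Hx) as [[_ ->]|[k [_ [_ [Hk _]]]]];
    [apply star_refl|].
  destruct (@ax_empty M k); apply Hk; auto.
- intros m n Hn IH Hm x Hx.
  destruct (level_inv Hx) as [[_ ->]|[k [y [Hk [Hk' [Hy Hf]]]]]]; [apply star_refl|].
  rewrite <- (succ_inj Hm Hk') in Hy; apply star_left with y; [|exact (IH y Hy)].
  split; [exact Hf | exact (level_in_X Hy)].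
Qed.

(** Two points of the same orbit are comparable.  The induction moves [y] one step down:
    a descent from [y] to [z] is either trivial or begins with that very step, because
    [f] is a function. *)
Lemma descends_linear x y z : x ∈ X -> descends x y -> descends x z ->
  descends y z \/ descends z y.
Proof.
intros Hx Hy Hz; revert y Hy.
refine (star_induction parent_definable parent_closed _ Hx _ _); [definable | now left|].
intros y y' Hxy [Hyz|Hzy] Hyy'; [|right; exact (star_right Hzy Hyy')].
assert (HyX : y ∈ X) by exact (f_dom (proj1 Hyy')).
destruct (star_first_step parent_definable parent_closed HyX Hyz) as [->|[c [Hc Hcz]]].
- right; apply star_right with y; [apply star_refl | exact Hyy'].
- left; now rewrite (f_unique (proj1 Hyy') (proj1 Hc)).
Qed.

Lemma descends_antisym n x y : level n x -> descends x y -> descends y x -> x = y.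
Proof.
intros Hx Hxy Hyx; destruct (descends_level Hx Hxy) as [|[m [Hm Hmn]]]; [auto|].
destruct (descends_level Hm Hyx) as [|[n' [Hn' Hnm]]]; [auto|].
rewrite <- (level_unique (level_nat Hx) Hx Hn') in Hnm; destruct (mem_asym Hmn Hnm).
Qed.

Variables (T R w : M).
Hypothesis T_set : is_set T.
Hypothesis T_spec : forall x, x ∈ T <-> exists n, level n x.
Hypothesis R_set : is_set R.
Hypothesis R_field : forall p, p ∈ R -> exists x y, is_pair p x y /\ x ∈ T /\ y ∈ T.
Hypothesis R_spec : forall y x, rel R y x <-> y ∈ T /\ x ∈ T /\ descends x y.
Hypothesis w_set : is_set w.
Hypothesis w_spec : forall n, n ∈ w <-> is_nat n.

Lemma T_in_X x : x ∈ T -> x ∈ X.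
Proof. intros H; apply T_spec in H; destruct H as [n H]; exact (level_in_X H). Qed.

Lemma root_in_T : r ∈ T.
Proof. apply T_spec; exists (empty M); exact level_zero. Qed.

Lemma root_least x : x ∈ T -> rel R r x.
Proof.
intros Hx; apply R_spec; split; [exact root_in_T|]; split; [exact Hx|].
apply T_spec in Hx; destruct Hx as [n Hx]; exact (descends_to_root (level_nat Hx) Hx).
Qed.

Lemma preimage_partial_order : partial_order T R.
Proof.
split; [exact T_set|]; split; [exact R_set|]; split; [exact R_field|].
split; [|split].
- intros x Hx; apply R_spec; auto using star_refl.
- intros x y Hxy Hyx; apply R_spec in Hxy, Hyx; destruct Hxy as [Hx [Hy Hxy]].
  apply T_spec in Hx; destruct Hx as [n Hx]; apply (descends_antisym Hx); tauto.
- intros x y z Hxy Hyz; apply R_spec in Hxy, Hyz; apply R_spec.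
  split; [tauto|]; split; [tauto|]; apply star_trans with y; tauto.
Qed.

Lemma preimage_linear x y z : rel R y x -> rel R z x -> rel R y z \/ rel R z y.
Proof.
intros Hy Hz; apply R_spec in Hy, Hz; destruct Hy as [Hy [Hx Hxy]], Hz as [Hz [_ Hxz]].
destruct (descends_linear (T_in_X Hx) Hxy Hxz) as [K|K];
  [right | left]; apply R_spec; auto.
Qed.

(** Below a fixed node, an element of minimal level is the least one, by comparability. *)
Lemma preimage_well_founded : well_founded_tree T R.
Proof.
assert (Hpo := preimage_partial_order).
split; [split; [exact Hpo|]; split|split].
- intros x y Hx Hy; exists r; auto using root_least.
- intros x _ y z; apply preimage_linear.
- exists r; split; [split; [exact root_in_T | exact root_least]|].
  intros r' [Hr' Hleast]; apply (proj1 (proj2 (proj2 (proj2 (proj2 Hpo))))).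
  + exact (root_least Hr').
  + exact (Hleast r root_in_T).
- intros x Hx S [y0 Hy0] HS.
  destruct (@separation M (fun n => exists y, y ∈ S /\ level n y) w) as [N [_ HN]];
    [definable|].
  assert (HST : forall y, y ∈ S -> exists n, n ∈ N /\ level n y).
  { intros y Hy; assert (HyT := HS y Hy); apply R_spec in HyT; destruct HyT as [HyT _].
    apply T_spec in HyT; destruct HyT as [n Hn]; exists n; split; [|exact Hn].
    apply HN; split; [apply w_spec, (level_nat Hn) | exists y; auto]. }
  destruct (@ax_foundation M N) as [n [Hn Hmin]].
  { destruct (HST y0 Hy0) as [n Hn]; exists n; tauto. }
  apply HN in Hn; destruct Hn as [_ [m [Hm Hlev]]]; exists m; split; [exact Hm|].
  intros y Hy; destruct (preimage_linear (HS m Hm) (HS y Hy)) as [K|K]; [exact K|].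
  apply R_spec in K; destruct K as [_ [_ K]].
  destruct (descends_level Hlev K) as [->|[k [Hk Hkn]]].
  + apply Hpo, T_spec; exists n; exact Hlev.
  + destruct (HST y Hy) as [k' [Hk' Hky]].
    rewrite (level_unique (level_nat Hky) Hky Hk) in Hk'; destruct (Hmin k Hk' Hkn).
Qed.

Lemma preimage_no_leaf : ~ exists x, is_leaf T R x.
Proof.
intros [x [Hx Hmax]]; destruct (f_onto (T_in_X Hx)) as [y Hy].
assert (HxX := T_in_X Hx); assert (HxT := Hx); apply T_spec in Hx; destruct Hx as [n Hx].
destruct (succ_exists n) as [m Hm].
assert (Hlev := level_succ (level_nat Hx) Hm Hx Hy).
assert (E : y = x).
{ apply Hmax, R_spec; split; [exact HxT|]; split; [apply T_spec; exists m; exact Hlev|].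
  apply star_right with y; [apply star_refl | split; assumption]. }
rewrite E in Hlev; apply (@mem_irrefl M n).
rewrite (level_unique (level_nat Hx) Hx Hlev) at 2; apply Hm; auto.
Qed.

Definition is_level_set n L := is_set L /\ forall x, x ∈ L <-> level n x.

Lemma level_set_exists n : exists L, is_level_set n L.
Proof.
destruct (@separation M (level n) X) as [L [HL K]]; [definable|].
exists L; split; [exact HL|]; intros x; rewrite K; split; [tauto|].
intros H; split; [exact (level_in_X H) | exact H].
Qed.

(** As long as [g] lists the sets of the points at each level, what remains before stage
    [b] are the points whose level is not below [b].  This covers omega as well, where
    nothing remains. *)
Lemma remaining_iff g b x :
  (forall c L, c ∈ b -> rel g c L <-> is_level_set c L) ->
  remaining T g b x <-> exists n, level n x /\ ~ n ∈ b.
Proof.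
intros Hg; split.
- intros [Hx K]; apply T_spec in Hx; destruct Hx as [n Hx]; exists n; split; [exact Hx|].
  intros Hn; apply K; destruct (level_set_exists n) as [L HL]; exists n, L.
  split; [exact Hn|]; split; [now apply Hg | now apply HL].
- intros [n [Hx Hn]]; split; [apply T_spec; exists n; exact Hx|].
  intros [c [L [Hc [HcL HxL]]]]; apply (Hg c L Hc) in HcL; apply HcL in HxL.
  apply Hn; now rewrite (level_unique (level_nat Hx) Hx HxL).
Qed.

(** A remaining point whose level exceeds [b] lies above its own image under [f], which
    still remains; so the minimal remaining points are those at level [b]. *)
Lemma next_level_nat g b L : is_nat b ->
  (forall c L', c ∈ b -> rel g c L' <-> is_level_set c L') ->
  is_next_level T R g b L <-> is_level_set b L.
Proof.
intros Hb Hg.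
assert (Hmin : forall x, (remaining T g b x /\
  forall y, remaining T g b y -> rel R y x -> y = x) <-> level b x).
{ intros x; rewrite (remaining_iff x Hg); split.
  - intros [[n [Hx Hn]] Hleast]; destruct (nat_trichotomy Hb (level_nat Hx)) as [K|[->|K]];
      [exfalso | exact Hx | contradiction].
    destruct (level_inv Hx) as [[-> _]|[k [y [Hk [Hnk [Hy Hf]]]]]];
      [exact (ax_empty K)|].
    assert (Hkb : ~ k ∈ b).
    { apply Hnk in K; intros Hkb; destruct K as [K| ->];
        [exact (mem_asym K Hkb) | exact (mem_irrefl Hkb)]. }
    assert (E : y = x).
    { apply Hleast; [apply remaining_iff; auto; exists k; auto|].
      apply R_spec; split; [apply T_spec; eauto|]; split; [apply T_spec; eauto|].
      apply star_right with x; [apply star_refl|].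
      split; [exact Hf | exact (level_in_X Hy)]. }
    rewrite E in Hy; rewrite (level_unique (level_nat Hx) Hx Hy) in Hnk.
    apply (@mem_irrefl M k), Hnk; auto.
  - intros Hx; split; [exists b; auto using mem_irrefl|].
    intros y Hy Hyx; apply (remaining_iff y Hg) in Hy; destruct Hy as [n [Hy Hn]].
    apply R_spec in Hyx; destruct Hyx as [_ [_ Hxy]].
    destruct (descends_level Hx Hxy) as [|[m [Hm Hmb]]]; [assumption|].
    destruct Hn; now rewrite (level_unique (level_nat Hy) Hy Hm). }
split; (intros [HL K]; split; [exact HL|]); intros x; rewrite K; [|symmetry]; apply Hmin.
Qed.

(** Uniqueness of the level sequence below a finite stage, by taking the first stage at
    which it would differ. *)
Lemma level_sequence_spec b g : ordinal b -> (forall n, n ∈ b -> is_nat n) ->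
  level_sequence T R b g -> forall c, c ∈ b -> forall L, rel g c L <-> is_level_set c L.
Proof.
intros Hb Hnat [Hg Hnext].
destruct (@separation M (fun c => ~ forall L, rel g c L <-> is_level_set c L) b)
  as [D [_ HD]]; [unfold is_level_set; definable|].
intros c Hc; apply NNPP; intros Hbad.
destruct (@ax_foundation M D) as [m [Hm K]]; [exists c; now apply HD|].
apply HD in Hm; destruct Hm as [Hmb Hm]; apply Hm; clear Hm.
assert (IH : forall d L', d ∈ m -> rel g d L' <-> is_level_set d L').
{ intros d L' Hd; revert L'; apply NNPP; intros Hbad'; apply (K d); [|exact Hd].
  apply HD; split; [|exact Hbad'].
  destruct Hb as [_ [_ [Htr _]]]; exact (Htr m d Hmb Hd). }
destruct (proj2 (proj2 Hg) m Hmb) as [L0 [HL0 _]].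
assert (HL0' := HL0); apply Hnext, (next_level_nat L0 (Hnat m Hmb) IH) in HL0'.
intros L; split.
- intros HL; rewrite (function_unique Hg HL HL0); exact HL0'.
- intros HL; replace L with L0; [exact HL0|].
  apply set_ext; [apply HL0' | apply HL |].
  intros x; rewrite (proj2 HL0'), (proj2 HL); reflexivity.
Qed.

(** The sets of points at each level form a level sequence that exhausts [T] at omega; at
    a finite stage the next level is not empty, because [f] is onto. *)
Lemma preimage_height : has_height T R w.
Proof.
destruct (ax_power X) as [PX HPX].
destruct (@function_comprehension M w PX is_level_set) as [g [Hg Kg]].
{ unfold is_level_set; definable. }
{ intros n Hn; destruct (level_set_exists n) as [L HL]; exists L; split.
  - split; [apply HPX; split; [apply HL|]|exact HL].
    intros x Hx; apply HL in Hx; exact (level_in_X Hx).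
  - intros L' [_ HL']; apply set_ext; [apply HL | apply HL'|].
    intros x; rewrite (proj2 HL), (proj2 HL'); reflexivity. }
assert (Hgw : forall c L, c ∈ w -> rel g c L <-> is_level_set c L).
{ intros c L Hc; rewrite Kg; split; [tauto|]; intros HL; split; [exact Hc|].
  split; [|exact HL]; apply HPX; split; [apply HL|].
  intros x Hx; apply HL in Hx; exact (level_in_X Hx). }
split.
- split; [exact (omega_ordinal w_set w_spec)|]; exists g; split; [split; [apply Hg|]|].
  + intros n L HnL; assert (Hn : n ∈ w) by (apply Kg in HnL; tauto).
    apply next_level_nat; [now apply w_spec | | now apply Hgw].
    intros c L' Hc; apply Hgw, w_spec; apply (nat_mem_nat (proj1 (w_spec n) Hn) Hc).
  + split; [apply empty_is_set|]; intros x; split; [intros K; destruct (ax_empty K)|].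
    intros [K _]; apply (remaining_iff x Hgw) in K; destruct K as [n [Hn Hnw]].
    destruct Hnw; apply w_spec, (level_nat Hn).
- intros b [Hb [g' [Hg' Hnext]]].
  destruct (ordinal_nat_or_ge_omega w_set w_spec Hb) as [Hnat|]; [exfalso | assumption].
  assert (Hspec := level_sequence_spec Hb (nat_mem_nat Hnat) Hg').
  apply next_level_nat in Hnext; auto.
  destruct (level_nonempty Hnat) as [x Hx]; apply Hnext in Hx; exact (ax_empty Hx).
Qed.

End PreimageTree.

Lemma surjection_tree (M : ZFA) (X Z f : M) : proper_subset X Z -> is_surjection f X Z ->
  exists T, subset T X /\ exists R w, well_founded_tree T R /\ is_omega w /\
    has_height T R w /\ ~ exists x, is_leaf T R x.
Proof.
intros HXZ [[Hf _] Hfs]; assert (HX : is_set X) by apply HXZ.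
destruct (proper_subset_point HXZ) as [a [HaZ HaX]], (Hfs a HaZ) as [r Hr].
assert (f_dom := fun x y => @function_dom M f X x y Hf).
assert (f_unique := fun x y y' => @function_unique M f X x y y' Hf).
assert (f_onto : forall y, y ∈ X -> exists x, rel f x y)
  by (intros y Hy; apply Hfs, HXZ, Hy).
assert (HrX := f_dom r a Hr).
destruct (omega_exists M) as [w [Hw Kw]].
destruct (@separation M (fun x => exists n, iterated_preimage f X r n x) X)
  as [T [HT KT]]; [definable|].
assert (KT' : forall x, x ∈ T <-> exists n, iterated_preimage f X r n x).
{ intros x; rewrite KT; split; [tauto|]; intros [n Hn]; split; [|eauto].
  exact (level_in_X f_dom HrX Hn). }
destruct (@relation_comprehension M T T (fun y x => star (parent f X) x y))
  as [R [HR [HRp KR]]]; [definable|].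
exists T; split.
- split; [exact HT|]; split; [exact HX|]; intros x Hx; apply KT in Hx; tauto.
- exists R, w; split; [|split; [|split]].
  + now apply preimage_well_founded with X f r a w.
  + now apply omega_is_omega.
  + now apply preimage_height with X f r a.
  + now apply preimage_no_leaf with X f r a.
Qed.

Theorem lemma2p1 (M : ZFA) (X : M) (HX : is_set X) :
  ~ card_in_Delta5 X <->
  exists T : M, subset T X /\
    exists R w : M, well_founded_tree T R /\ is_omega w /\ has_height T R w /\
      ~ exists x : M, is_leaf T R x.
Proof.
rewrite (not_Delta5_iff HX); split.
- intros [f [Z [HZ Hf]]]; exact (surjection_tree HZ Hf).
- intros [T [HT [R [w [Hwf [_ [_ Hleaf]]]]]]]; exact (tree_surjection HX HT Hwf Hleaf).
Qed.
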